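(* Let $n$ be a positive integer and let $B_n$ be the semigroup of all binary relations on $N=\{1,2,\dots,n\}$, with zero element the empty relation. (a) $B_n$ contains exactly $n!$ maximal nilpotent subsemigroups, each of nilpotency class $n$. (b) For every $k\in\mathbb{N}$ with $1\leq k\leq n$, $B_n$ contains exactly $\sum_{i=0}^{k-1}(-1)^i\binom{k}{i}(k-i)^n$ maximal nilpotent subsemigroups of nilpotency class $k$. (c) If $T_1$ and $T_2$ are two maximal nilpotent subsemigroups of $B_n$, then there exists a permutation $\pi\in S_n$ such that $T_2=\pi^{-1}T_1\pi$; in particular, all maximal nilpotent subsemigroups of $B_n$ are isomorphic. (d) Every maximal nilpotent subsemigroup of $B_n$ consists of $2^{n(n-1)/2}$ elements.
   Context: The product of relations $\alpha,\beta$ is $\alpha\beta=\{(i,j):(i,l)\in\alpha,\ (l,j)\in\beta\text{ for some }l\in N\}$. $S_n$ is the symmetric group on $N$, a permutation $\pi$ being identified with the relation $\{(i,\pi(i)):i\in N\}$. A subsemigroup $T$ of a semigroup with zero $0$ is nilpotent if $T^m=\{0\}$ for some $m\in\mathbb{N}$; the least such $m$ is its nilpotency class. A maximal nilpotent subsemigroup is an inclusion-maximal nilpotent subsemigroup. In (b), a ''maximal nilpotent subsemigroup of nilpotency class $k$'' means an inclusion-maximal element of the set of all nilpotent subsemigroups of nilpotency class $\leq k$. *)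

(* Defs.v *)
From HB Require Import structures.
From mathcomp Require Import all_boot all_order all_algebra all_fingroup.
From mathcomp Require Import boolp.
Set Implicit Arguments.
Unset Strict Implicit.
Unset Printing Implicit Defensive.

Local Open Scope group_scope.

(* N = {1, ..., n} is represented by 'I_n = {0, ..., n - 1}.  The alias keeps  *)
(* the product below apart from the pointwise product on {set gT}.            *)
Definition binrel (n : nat) : Type := {set 'I_n * 'I_n}.

HB.instance Definition _ (n : nat) := Finite.copy (binrel n) {set 'I_n * 'I_n}.

Section BinrelOps.
Variable n : nat.
Implicit Types a b c : binrel n.

Definition relmul a b : binrel n :=
  [set p | [exists l, ((p.1, l) \in a) && ((l, p.2) \in b)]].
Definition relone : binrel n := [set p | p.1 == p.2].
Definition relconv a : binrel n := [set p | (p.2, p.1) \in a].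
Definition relzero : binrel n := set0.

Lemma relmulP a b i j :
  reflect (exists2 l, (i, l) \in a & (l, j) \in b) ((i, j) \in relmul a b).
Proof.
rewrite inE /=; apply: (iffP existsP) => [[l /andP[al bl]]|[l al bl]].
  by exists l.
by exists l; rewrite al.
Qed.

Lemma relmulA : associative relmul.
Proof.
move=> a b c; apply/setP=> -[i j]; apply/relmulP/relmulP.
- by move=> [l al /relmulP[k bk ck]]; exists k => //; apply/relmulP; exists l.
- by move=> [k /relmulP[l al bl] ck]; exists l => //; apply/relmulP; exists k.
Qed.

Lemma relmul1 : left_id relone relmul.
Proof.
move=> a; apply/setP=> -[i j]; apply/relmulP/idP => [[l]|aij].
  by rewrite inE /= => /eqP ->.
by exists i; rewrite // inE.
Qed.

Lemma relconvK : involutive relconv.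
Proof. by move=> a; apply/setP=> -[i j]; rewrite !inE. Qed.

Lemma relconvM : {morph relconv : a b / relmul a b >-> relmul b a}.
Proof.
move=> a b; apply/setP=> -[i j]; rewrite inE /=.
apply/relmulP/relmulP => -[l]; first by exists l; rewrite inE.
by rewrite !inE; exists l.
Qed.

End BinrelOps.

(* With the converse as involution, B_n is a finite *-monoid, which gives     *)
(* {set binrel n} the pointwise product A * B and its powers A ^+ m.         *)
(* Pitfall: a^-1 for a : binrel n is the converse, not a group inverse.       *)
HB.instance Definition _ (n : nat) :=
  isStarMonoid.Build (binrel n) (@relmulA n) (@relmul1 n) (@relconvK n)
    (@relconvM n).

Definition permrel (n : nat) (s : 'S_n) : binrel n := [set (i, s i) | i : 'I_n].

Section Nilpotent.
Variable n : nat.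
Implicit Types T U : {set binrel n}.

Definition zero_set : {set binrel n} := [set relzero n].

Definition subsemigroup T : Prop :=
  T != set0 /\ {in T &, forall a b, a * b \in T}.

(* Exponents are positive: for sets, A ^+ 0 is the singleton of the identity. *)
Definition nilpotent_subsemigroup T : Prop :=
  subsemigroup T /\ exists m, 0 < m /\ T ^+ m = zero_set.

Definition nilpotency_class T (k : nat) : Prop :=
  [/\ 0 < k, T ^+ k = zero_set &
      forall m, 0 < m -> T ^+ m = zero_set -> k <= m].

Definition inclusion_maximal (P : {set binrel n} -> Prop) T : Prop :=
  P T /\ forall U, P U -> T \subset U -> U = T.

Definition maximal_nilpotent : {set binrel n} -> Prop :=
  inclusion_maximal nilpotent_subsemigroup.

Definition maximal_nilpotent_of_class (k : nat) : {set binrel n} -> Prop :=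
  inclusion_maximal (fun T =>
    nilpotent_subsemigroup T /\ exists2 c, nilpotency_class T c & c <= k).

Definition subsemigroup_isomorphic T U : Prop :=
  exists f : binrel n -> binrel n,
    [/\ {in T &, injective f}, f @: T = U &
        {in T &, forall a b, f (a * b) = f a * f b}].

End Nilpotent.

(* Main.v *)
(* The union of a nilpotent subsemigroup T is a strict partial order, and     *)
(* T ^+ k = 0 says that it has no chain of k steps.  Such an order is         *)
(* contained in {(i, j) : f i < f j} for some level function f to             *)
(* {0, ..., k - 1}, and f can be taken surjective when k <= n.  Conversely,   *)
(* the subsets of {(i, j) : f i < f j} form a nilpotent subsemigroup, and for *)
(* surjective f it determines f and is contained in no other one.  So the     *)
(* maximal objects of class k correspond to the surjections from N to         *)
(* {0, ..., k - 1}, and for k = n to the bijections.                          *)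
Require Import Defs.
From mathcomp Require Import all_boot all_order all_algebra all_fingroup.
From mathcomp Require Import boolp zify.

Set Implicit Arguments.
Unset Strict Implicit.
Unset Printing Implicit Defensive.

Local Open Scope group_scope.

(** All four claims follow from one classification, [maximal_nilpotent_of_classP]. Existence is
    [nilpotent_sub_level] followed by [surjective_refinement]; incomparability of distinct level
    semigroups is [surjection_order_rigid]. By [nilpotent_expg_card] a nilpotent subsemigroup has
    class at most [n], so plain maximality is the case [k = n], where level functions are
    bijections. Then (a) counts bijections, (b) counts surjections by inclusion-exclusion, (c) holds
    because two bijections differ by a relabelling of the points, and (d) counts the subsets of a
    strict linear order on [n] points. *)

Lemma mulrelP n (a b : binrel n) i j :
  reflect (exists2 l, (i, l) \in a & (l, j) \in b)
    ((i, j) \in (a * b : binrel n)).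
Proof. exact: relmulP. Qed.

(** * Level functions and the semigroups they define *)

Section Levels.
Variables n k : nat.
Implicit Types (f g : {ffun 'I_n -> 'I_k}) (a b : binrel n).

Definition level_rel f : binrel n := [set p | f p.1 < f p.2].

Definition level_semigroup f : {set binrel n} :=
  [set a : binrel n | a \subset level_rel f].

Definition surjections : {set {ffun 'I_n -> 'I_k}} :=
  [set f : {ffun 'I_n -> 'I_k} | [forall v, v \in codom f]].

Lemma surjectionsP f :
  reflect (forall v, exists i, f i = v) (f \in surjections).
Proof.
rewrite inE; apply: (iffP forallP) => fsurj v.
  by have /codomP[i ->] := fsurj v; exists i.
by have [i <-] := fsurj v; apply: codom_f.
Qed.

Lemma level_semigroupP f a :
  reflect (forall i j, (i, j) \in a -> f i < f j) (a \in level_semigroup f).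
Proof.
rewrite inE; apply: (iffP subsetP) => [af i j /af|af [i j] /af].
  by rewrite inE.
by rewrite inE.
Qed.

Lemma level_semigroup_subset f g :
  (level_semigroup f \subset level_semigroup g) ->
  forall i j, f i < f j -> g i < g j.
Proof.
move=> /subsetP fg i j ltf.
have /fg/level_semigroupP : ([set (i, j)] : binrel n) \in level_semigroup f.
  by apply/level_semigroupP => x y /set1P[-> ->].
by apply; apply: set11.
Qed.

(** Through each point runs a chain with one point on each of the [k] levels of [f]. Along it [g]
    increases strictly within [k] values, so no value is free: induction from the bottom gives
    [f <= g], from the top [g <= f]. *)
Lemma surjection_order_rigid f g : f \in surjections ->
  (forall i j, f i < f j -> g i < g j) -> f = g.
Proof.
move=> /surjectionsP fsurj fg.
have le_fg v : forall i, f i = v :> nat -> v <= g i.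
  elim: v => // v IHv i fi.
  have ltvk : v < k by rewrite -ltnS -fi; have := ltn_ord (f i); lia.
  have [j fj] := fsurj (Ordinal ltvk).
  have := IHv j; rewrite fj => /(_ erefl) vg.
  by have := fg j i; rewrite fj fi /= => /(_ (ltnSn v)); lia.
have le_gf v : forall i, k = f i + v.+1 -> g i + v < k.
  elim: v => [|v IHv] i fi; first by rewrite addn0.
  have ltvk : (f i).+1 < k by lia.
  have [j fj] := fsurj (Ordinal ltvk).
  have := IHv j; rewrite fj /= => /(_ ltac:(lia)) vg.
  by have := fg i j; rewrite fj /= => /(_ (ltnSn _)); lia.
apply/ffunP=> i; apply/val_inj/eqP; rewrite eqn_leq /=.
rewrite (le_fg (f i)) //=.
have ltf := ltn_ord (f i).
by have := le_gf (k - (f i).+1) i; lia.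
Qed.

Lemma level_semigroup_inj : {in surjections &, injective level_semigroup}.
Proof.
move=> f g fS gS efg; apply: surjection_order_rigid => //.
by apply: level_semigroup_subset; rewrite efg.
Qed.

(* A level that is missed leaves room to split a level with two elements,     *)
(* which enlarges [level_rel].                                                *)
Lemma level_rel_refine f : k <= n -> f \notin surjections ->
  exists2 g : {ffun 'I_n -> 'I_k}, (forall i j, f i < f j -> g i < g j) &
    #|level_rel f| < #|level_rel g|.
Proof.
move=> lekn; rewrite inE negb_forall => /existsP[v vf].
have /injectivePn[i [j neq_ij fij]] : ~~ injectiveb f.
  apply/negP=> /injectiveP finj.
  have := card_codom finj; rewrite card_ord => cf.
  have : #|codom f| < k.
    rewrite -[X in _ < X]card_ord; apply: proper_card; apply/properP.
    by split; [apply/subsetP | exists v].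
  by rewrite cf ltnNge lekn.
have neq_ji : (j == i) = false by rewrite eq_sym (negPf neq_ij).
have fv x : f x != v :> nat.
  by apply: contraNneq vf => /val_inj <-; apply: codom_f.
suff [g fg gij] : exists2 g : {ffun 'I_n -> 'I_k},
    (forall i j, f i < f j -> g i < g j) & g i != g j :> nat.
  exists g => //; apply: proper_card; apply/properP; split.
    by apply/subsetP=> -[x y]; rewrite !inE; apply: fg.
  have [ltg|ltg|eqg] := ltngtP (g i) (g j).
  - by exists (i, j); rewrite !inE //= fij ltnn.
  - by exists (j, i); rewrite !inE //= fij ltnn.
  - by rewrite eqg eqxx in gij.
have ltv := ltn_ord v; have ltfi := ltn_ord (f i).
case: (ltngtP v (f i)) => [ltvi|gtvi|/esym eqvi]; last 1 first.
- by have := fv i; rewrite eqvi eqxx.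
(* Levels strictly between [v] and [f i] sink by one into the gap at [v]; this frees the level just
   below [f i] for [i] alone, while [j] stays. *)
- pose h x := f x - ((v < f x < f i) || (x == i)).
  have hk x : h x < k by have := ltn_ord (f x); rewrite /h; lia.
  exists [ffun x => Ordinal (hk x)] => [x y|]; rewrite !ffunE /= /h.
    have := fv x; have := fv y.
    by case: (x =P i) => [->|_]; case: (y =P i) => [->|_]; lia.
  by rewrite eqxx neq_ji -fij; lia.
(* The mirror image: the levels between rise into the gap and [i] moves up. *)
- pose h x := f x + ((f i < f x < v) || (x == i)).
  have hk x : h x < k.
    by have := ltn_ord (f x); rewrite /h; case: (x =P i) => [->|_]; lia.
  exists [ffun x => Ordinal (hk x)] => [x y|]; rewrite !ffunE /= /h.
    have := fv x; have := fv y.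
    by case: (x =P i) => [->|_]; case: (y =P i) => [->|_]; lia.
  by rewrite eqxx neq_ji -fij; lia.
Qed.

(** Among the level functions whose relation contains that of [f], one with the most pairs cannot be
    refined, hence misses no level. *)
Lemma surjective_refinement f : k <= n ->
  exists2 g : {ffun 'I_n -> 'I_k}, g \in surjections & level_semigroup f \subset level_semigroup g.
Proof.
move=> lekn; pose P g := level_rel f \subset level_rel g.
have Pf : P f by apply: subxx.
case: (@arg_maxnP _ f P (fun g => #|level_rel g|) Pf) => g fg gmax.
exists g; last first.
  by apply/subsetP=> a; rewrite !inE => af; apply: subset_trans fg.
apply: contraT => /(level_rel_refine lekn)[h gh lt_gh].
suff /gmax : P h by rewrite /= leqNgt lt_gh.
apply/subsetP=> -[x y] /(subsetP fg).
by rewrite !inE; apply: gh.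
Qed.

Lemma level_semigroup_exp f m a i j :
  a \in level_semigroup f ^+ m -> (i, j) \in a -> f i + m <= f j.
Proof.
elim: m a i j => [|m IHm] a i j.
  by rewrite expg0 => /set1P-> ; rewrite inE /= => /eqP ->; rewrite addn0.
rewrite expgS => /mulsgP[b c /level_semigroupP bf cm ->] /mulrelP[l ibl lcj].
by have := bf _ _ ibl; have := IHm _ _ _ cm lcj; lia.
Qed.

(** Surjectivity provides a point on each intermediate level, and the pair factors through them.
    This bounds the nilpotency class from below. *)
Lemma set1_level_semigroup_exp f m i j : f \in surjections ->
  f j = f i + m.+1 :> nat ->
  ([set (i, j)] : binrel n) \in level_semigroup f ^+ m.+1.
Proof.
move=> fS; elim: m i => [|m IHm] i fij.
  by rewrite expg1; apply/level_semigroupP => x y /set1P[-> ->]; lia.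
have ltk : (f i).+1 < k by have := ltn_ord (f j); lia.
have [l fl] := surjectionsP _ fS (Ordinal ltk).
rewrite expgS; apply/mulsgP.
exists ([set (i, l)] : binrel n) ([set (l, j)] : binrel n).
- by apply/level_semigroupP => x y /set1P[-> ->]; rewrite fl /=.
- by apply: IHm; rewrite fl /=; lia.
apply/setP=> -[x y]; apply/set1P/mulrelP => [[-> ->]|[z]].
  by exists l; apply: set11.
by move=> /set1P[-> _] /set1P[_ ->].
Qed.

End Levels.

(** * Nilpotent subsemigroups and the classification of the maximal ones *)

Section NilpotentSubsemigroups.
Variable n : nat.
Implicit Types T U : {set binrel n}.

Lemma relzeroM (a : binrel n) : relzero n * a = relzero n.
Proof. by apply/setP=> -[i j]; apply/mulrelP/idP => [[l]|]; rewrite inE. Qed.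

Lemma expg_subsemigroup T m : subsemigroup T -> T ^+ m.+1 \subset T.
Proof.
move=> [_ TM]; elim: m => [|m IHm]; first by rewrite expg1.
rewrite expgS; apply/subsetP=> _ /mulsgP[a b aT /(subsetP IHm) bT ->].
exact: TM.
Qed.

Lemma zero_in_expg T m :
  relzero n \in T -> 0 < m -> relzero n \in T ^+ m.
Proof.
move=> T0; case: m => // m _; elim: m => [|m IHm]; first by rewrite expg1.
by rewrite expgS; apply/mulsgP; exists (relzero n) (relzero n); rewrite ?relzeroM.
Qed.

Lemma zero_in_nilpotent T m :
  subsemigroup T -> 0 < m -> T ^+ m = zero_set n -> relzero n \in T.
Proof.
move=> sT; case: m => // m _ Tm.
by apply: (subsetP (expg_subsemigroup m sT)); rewrite Tm set11.
Qed.

Lemma expg_zero_leq T m k : subsemigroup T -> 0 < m -> m <= k ->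
  T ^+ m = zero_set n -> T ^+ k = zero_set n.
Proof.
move=> sT m0 lemk Tm; apply/setP=> a; apply/idP/set1P => [|->].
  rewrite -(subnKC lemk) expgD Tm => /mulsgP[b c /set1P-> _ ->].
  exact: relzeroM.
by apply: zero_in_expg; [apply: zero_in_nilpotent sT m0 Tm | lia].
Qed.

(** Once a power of [T] is zero, all later ones are, so a bound on the class becomes a single
    equation. *)
Lemma nilpotent_of_classP T k : 0 < k ->
  (nilpotent_subsemigroup T /\ exists2 c, nilpotency_class T c & c <= k) <->
  subsemigroup T /\ T ^+ k = zero_set n.
Proof.
move=> k0; split=> [[[sT _] [c [c0 Tc _] leck]]|[sT Tk]].
  by split=> //; apply: expg_zero_leq leck Tc.
split; first by split=> //; exists k.
pose P m := (0 < m) && (T ^+ m == zero_set n).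
have exP : exists m, P m by exists k; rewrite /P k0 Tk eqxx.
case: (ex_minnP exP) => c /andP[c0 /eqP Tc] minc; exists c.
  by split=> // m m0 Tm; apply: minc; rewrite /P m0 Tm eqxx.
by apply: minc; rewrite /P k0 Tk eqxx.
Qed.

(* The level of [i] is the length of a longest chain of the union of [T]      *)
(* ending in [i].                                                             *)
Lemma nilpotent_sub_level T k : 0 < k -> T ^+ k = zero_set n ->
  exists f : {ffun 'I_n -> 'I_k}, T \subset level_semigroup f.
Proof.
case: k => // k _ Tk.
pose Q m i := [exists a in T ^+ m.+1, exists l, (l, i) \in (a : binrel n)].
have QP m i : reflect (exists a l, a \in T ^+ m.+1 /\ (l, i) \in (a : binrel n))
    (Q m i).
  apply: (iffP exists_inP) => [[a aT /existsP[l al]]|[a [l [aT al]]]].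
    by exists a, l.
  by exists a => //; apply/existsP; exists l.
have Qk i : Q k i = false.
  by apply/QP=> -[a [l []]]; rewrite Tk => /set1P ->; rewrite inE.
pose h i := \sum_(m < k.+1) Q m i.
have hE i : h i = \sum_(m < k) Q m i by rewrite /h big_ord_recr /= Qk addn0.
have hk i : h i < k.+1.
  rewrite hE ltnS -[X in _ <= X]card_ord -sum1_card leq_sum // => m _.
  exact: leq_b1.
exists [ffun i => Ordinal (hk i)].
apply/subsetP=> a aT; apply/level_semigroupP=> i j aij; rewrite !ffunE /=.
(* Appending [(i, j)] to a chain ending in [i] shows that [Q m i] implies [Q m.+1 j]; the extra term
   [Q 0 j] makes the inequality strict. *)
rewrite hE /h big_ord_recl /=.
have -> : Q 0 j by apply/QP; exists a, i; rewrite expg1.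
rewrite ltnS leq_sum // => m _; rewrite -[bump 0 m]/m.+1.
case: (QP m i) => // -[b [l [bT bli]]].
suff -> : Q m.+1 j by [].
apply/QP; exists (b * a), l; split.
  by rewrite expgSr; apply/mulsgP; exists b a.
by apply/mulrelP; exists i.
Qed.

Lemma level_semigroup_nilpotent k (f : {ffun 'I_n -> 'I_k}) : 0 < k ->
  subsemigroup (level_semigroup f) /\ level_semigroup f ^+ k = zero_set n.
Proof.
case: k f => // k f _.
have f0 : relzero n \in level_semigroup f.
  by apply/level_semigroupP=> i j; rewrite inE.
split.
  split; first by apply/set0Pn; exists (relzero n).
  move=> a b /level_semigroupP af /level_semigroupP bf.
  apply/level_semigroupP=> i j /mulrelP[l /af fil /bf flj].
  exact: ltn_trans flj.
apply/setP=> a; apply/idP/set1P => [af|->]; last exact: zero_in_expg.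
apply/setP=> -[i j]; rewrite inE; apply/negP=> /(level_semigroup_exp af).
by have := ltn_ord (f j); lia.
Qed.

Lemma maximal_nilpotent_of_classP T k : 0 < k <= n ->
  maximal_nilpotent_of_class k T <->
  exists2 f : {ffun 'I_n -> 'I_k}, f \in surjections n k & T = level_semigroup f.
Proof.
move=> /andP[k0 lekn].
have sub_surj U : U ^+ k = zero_set n ->
    exists2 f : {ffun 'I_n -> 'I_k}, f \in surjections n k &
      U \subset level_semigroup f.
  move=> /(nilpotent_sub_level k0)[f Uf].
  by have [g gS /(subset_trans Uf)] := surjective_refinement f lekn; exists g.
split=> [[/(nilpotent_of_classP _ k0)[sT Tk] Tmax]|[f fS ->]].
  have [f fS Tf] := sub_surj _ Tk; exists f => //; apply/esym/Tmax => //.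
  exact/(nilpotent_of_classP _ k0)/level_semigroup_nilpotent.
split; first exact/(nilpotent_of_classP _ k0)/level_semigroup_nilpotent.
move=> U /(nilpotent_of_classP _ k0)[sU Uk] fU.
have [g gS Ug] := sub_surj _ Uk.
suff fg : f = g by apply/eqP; rewrite eqEsubset fU fg Ug.
apply: surjection_order_rigid => //; apply: level_semigroup_subset.
exact: subset_trans Ug.
Qed.

Lemma level_semigroup_class k (f : {ffun 'I_n -> 'I_k}) : 0 < k ->
  f \in surjections n k -> nilpotency_class (level_semigroup f) k.
Proof.
move=> k0 fS; split=> //; first by have [] := level_semigroup_nilpotent f k0.
case=> // m _ fm; rewrite leqNgt; apply/negP=> ltmk.
(* A pair from level 0 to level [m.+1] is a nonzero element of the power assumed to vanish. *)
have [i fi] := surjectionsP _ fS (Ordinal k0).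
have [j fj] := surjectionsP _ fS (Ordinal ltmk).
have := @set1_level_semigroup_exp _ _ f m i j fS; rewrite fi fj fm /=.
move=> /(_ erefl)/set1P/setP/(_ (i, j)).
by rewrite set11 inE.
Qed.

(* Replacing the level of [i] by the number of points of lower level makes    *)
(* at most [n] levels.                                                        *)
Lemma nilpotent_expg_card T : 0 < n -> nilpotent_subsemigroup T ->
  T ^+ n = zero_set n.
Proof.
move=> n0 [sT [m [m0 Tm]]].
have T0 := zero_in_nilpotent sT m0 Tm.
have [f /subsetP Tf] := nilpotent_sub_level m0 Tm.
pose h i := #|[set l | f l < f i]|.
have hn i : h i < n.
  rewrite -[X in _ < X]card_ord -cardsT; apply: proper_card; apply/properP.
  by split; [apply: subsetT | exists i; rewrite inE // ltnn].
pose g := [ffun i => Ordinal (hn i)].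
have Tg : T \subset level_semigroup g.
  apply/subsetP=> a /Tf/level_semigroupP af.
  apply/level_semigroupP=> i j /af ltf; rewrite !ffunE /=.
  apply: proper_card; apply/properP; split.
    by apply/subsetP=> l; rewrite !inE => /ltn_trans; apply.
  by exists i; rewrite inE ?ltnn.
apply/setP=> a; apply/idP/set1P => [aT|->].
  apply/set1P; rewrite -/(zero_set n).
  have [_ <-] := level_semigroup_nilpotent g n0.
  have expS r : T ^+ r \subset level_semigroup g ^+ r.
    elim: r => // r IHr; rewrite !expgS; exact: mulgSS.
  exact: (subsetP (expS n)).
exact: zero_in_expg.
Qed.

Lemma maximal_nilpotentP T : 0 < n ->
  maximal_nilpotent T <->
  exists2 f : {ffun 'I_n -> 'I_n}, f \in surjections n n & T = level_semigroup f.
Proof.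
move=> n0.
have nilE U : nilpotent_subsemigroup U <-> nilpotent_subsemigroup U /\
    exists2 c, nilpotency_class U c & c <= n.
  split=> [nilU|[]//]; apply/nilpotent_of_classP => //.
  by split; [case: nilU | apply: nilpotent_expg_card].
rewrite -maximal_nilpotent_of_classP ?n0 ?leqnn //.
split=> -[TP Tmax]; split.
- exact/nilE.
- by move=> U /nilE; apply: Tmax.
- exact/nilE.
- by move=> U /nilE; apply: Tmax.
Qed.

End NilpotentSubsemigroups.

(** * Counting bijections and surjections *)

Section Counting.
Import GRing.Theory.

Lemma surjections_bij n (f : {ffun 'I_n -> 'I_n}) :
  (f \in surjections n n) = injectiveb f.
Proof.
rewrite inE; apply/forallP/injectiveP => [fsurj|finj v]; last first.
  exact: inj_card_onto.
have fT : codom f =i 'I_n by move=> v; rewrite fsurj.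
have /image_injP fI : #|image f 'I_n| == #|'I_n| by rewrite -(eq_card fT).
by move=> i j; apply: fI.
Qed.

Lemma card_surjections_fact n : #|surjections n n| = n`!.
Proof.
have := card_inj_ffuns 'I_n 'I_n; rewrite !card_ord ffactnn => <-.
by apply: eq_card => f; rewrite surjections_bij inE.
Qed.

Local Open Scope ring_scope.

(** Grouping the subsets by size gives the binomial expansion of [(1 - 1) ^+ #|C|]. *)
Lemma sum_subset_sign (T : finType) (C : {set T}) :
  \sum_(S : {set T} | S \subset C) (-1) ^+ #|S| = (C == set0)%:R :> int.
Proof.
rewrite (partition_big (fun S : {set T} => inord #|S| : 'I_#|C|.+1) xpredT) //=.
have -> : (C == set0)%:R = (1 - 1) ^+ #|C| :> int.
  by rewrite subrr expr0n cards_eq0.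
rewrite exprBn; apply: eq_bigr => i _.
rewrite (eq_bigr (fun _ => (-1) ^+ i)); last first.
  move=> S /andP[SC /eqP <-]; rewrite inordK // ltnS; exact: subset_leq_card.
rewrite sumr_const !expr1n !mulr1 -cards_draws cardsE; congr (_ *+ _).
apply: eq_card => S; rewrite !unfold_in.
case SC: (S \subset C) => //=; rewrite -val_eqE /= inordK // ltnS.
exact: subset_leq_card.
Qed.

(** Inclusion-exclusion over sets [S] of missed values: the functions missing [S] are those into its
    complement. *)
Lemma card_surjections n k : (0 < n)%N ->
  #|surjections n k|%:Z =
  \sum_(i < k) (-1) ^+ i * 'C(k, i)%:Z * (k - i)%N%:Z ^+ n.
Proof.
move=> n0.
pose missed (f : {ffun 'I_n -> 'I_k}) := [set v | v \notin codom f].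
transitivity (\sum_(f : {ffun 'I_n -> 'I_k})
    \sum_(S : {set 'I_k} | S \subset missed f) (-1) ^+ #|S| : int).
  rewrite -natz -sum1_card natr_sum big_mkcond /=; apply: eq_bigr => f _.
  rewrite sum_subset_sign inE.
  suff -> : (missed f == set0) = [forall v, v \in codom f] by case: forallP.
  apply/eqP/forallP => [m0 v|fsurj]; last first.
    by apply/setP=> v; rewrite !inE fsurj.
  by have := in_set0 v; rewrite -m0 inE => /negbFE.
rewrite (exchange_big_dep xpredT) //=.
have count (S : {set 'I_k}) :
    #|[pred f : {ffun 'I_n -> 'I_k} | S \subset missed f]| = ((k - #|S|) ^ n)%N.
  have := card_ffun_on 'I_n (mem (~: S)); rewrite card_ord.
  have -> : #|mem (~: S)| = (k - #|S|)%N.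
    by rewrite -[X in (X - _)%N](card_ord k) -(cardsC S) addKn.
  move=> <-.
  apply: eq_card => f; rewrite unfold_in /=; apply/subsetP/ffun_onP => [Sf i|fS v vS].
    rewrite inE; apply/negP=> /Sf; rewrite inE => /negP; apply.
    exact: codom_f.
  rewrite inE; apply/negP=> /codomP[i vi].
  by have := fS i; rewrite inE -vi vS.
transitivity (\sum_(S : {set 'I_k}) (-1) ^+ #|S| * (k - #|S|)%N%:Z ^+ n : int).
  apply: eq_bigr => S _; rewrite sumr_const -mulr_natr count.
  by rewrite natrX natz.
have cardS_lt (S : {set 'I_k}) : (#|S| < k.+1)%N.
  by rewrite ltnS -[X in (_ <= X)%N]card_ord max_card.
rewrite (partition_big (fun S : {set 'I_k} => inord #|S| : 'I_k.+1) xpredT) //=.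
rewrite [LHS](eq_bigr (fun i : 'I_k.+1 =>
    (-1) ^+ i * 'C(k, i)%:Z * (k - i)%N%:Z ^+ n)) => [|i _].
  (* The term [i = k] is a multiple of [0 ^+ n], which vanishes because [n] is positive. *)
  by rewrite big_ord_recr /= subnn expr0n eqn0Ngt n0 mulr0 addr0.
rewrite (eq_bigr (fun _ => (-1) ^+ i * (k - i)%N%:Z ^+ n)); last first.
  by move=> S /eqP <-; rewrite inordK.
rewrite sumr_const mulrAC -mulr_natr natz; congr (_ * Posz _).
have := cards_draws [set: 'I_k] i; rewrite cardsT card_ord => <-.
rewrite cardsE; apply: eq_card => S.
by rewrite !unfold_in subsetT /= inordK.
Qed.

End Counting.

(** * Conjugation by permutations, and the size of a maximal semigroup *)

Section Conjugation.
Variable n : nat.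
Implicit Types (a b : binrel n) (s : 'S_n).

(** Relations compose from left to right, so this relabels the points of [a] by [s]. *)
Definition conjrel s a : binrel n := permrel s^-1 * a * permrel s.

Lemma conjrelE s a i j : ((i, j) \in conjrel s a) = ((s^-1 i, s^-1 j) \in a).
Proof.
apply/mulrelP/idP => [[l /mulrelP[x]]|aij].
  by move=> /imsetP[z _ [-> ->]] xl /imsetP[y _ [ly ->]]; rewrite permK -ly.
exists (s^-1 j); last by apply/imsetP; exists (s^-1 j); rewrite ?permKV.
by apply/mulrelP; exists (s^-1 i) => //; apply: imset_f.
Qed.

Lemma conjrel_inj s : injective (conjrel s).
Proof.
move=> a b /setP eqab; apply/setP=> -[i j].
by have := eqab (s i, s j); rewrite !conjrelE !permK.
Qed.

Lemma conjrelM s a b : conjrel s (a * b) = conjrel s a * conjrel s b.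
Proof.
apply/setP=> -[i j]; rewrite conjrelE; apply/mulrelP/mulrelP => -[l al bl].
  by exists (s l); rewrite conjrelE permK.
by exists (s^-1 l); rewrite -conjrelE.
Qed.

Lemma conj_level_semigroup k s (f g : {ffun 'I_n -> 'I_k}) :
  (forall i, g (s i) = f i) ->
  conjrel s @: level_semigroup f = level_semigroup g.
Proof.
move=> gs; apply/setP=> a; apply/imsetP/level_semigroupP.
  move=> [b /level_semigroupP bf ->] i j.
  by rewrite conjrelE => /bf; rewrite -!gs !permKV.
move=> ag; exists (conjrel s^-1 a).
  apply/level_semigroupP=> i j; rewrite conjrelE invgK => /ag.
  by rewrite !gs.
by apply/setP=> -[i j]; rewrite !conjrelE invgK !permKV.
Qed.

Lemma card_level_semigroup (f : {ffun 'I_n -> 'I_n}) :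
  f \in surjections n n -> #|level_semigroup f| = (2 ^ ((n * (n - 1)) %/ 2))%N.
Proof.
rewrite surjections_bij => /injectiveP finj.
have -> : #|level_semigroup f| = #|powerset (level_rel f)|.
  by apply: eq_card => a; rewrite !inE.
rewrite card_powerset; congr (2 ^ _)%N.
(* The exponent becomes the sum of all [j < n]; after reindexing by [f], it is matched column by
   column, as [f j] points lie below [j]. *)
rewrite subn1 divn2 -bin2 -bin2_sum big_mkord.
rewrite -sum1_card (eq_bigl (fun p => f p.1 < f p.2)); last first.
  by move=> p; rewrite inE.
rewrite -(pair_big_dep xpredT (fun i j => f i < f j) (fun _ _ => 1%N)) /=.
rewrite (exchange_big_dep xpredT) //= [RHS](reindex_inj finj) /=.
apply: eq_bigr => j _.
rewrite -(@reindex_inj _ _ _ _ f (fun i => i < f j) (fun=> 1%N) finj).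
by rewrite -(big_ord_widen n (fun=> 1%N)) ?sum1_card ?card_ord // ltnW.
Qed.

End Conjugation.

Theorem theorem6p1 (n : nat) (hn : (0 < n)%N) :
  [/\ (* (a) *)
      #|[set T : {set binrel n} | `[< maximal_nilpotent T >]]| = n`! /\
      (forall T : {set binrel n}, maximal_nilpotent T -> nilpotency_class T n),
      (* (b) *)
      (forall k : nat, (1 <= k <= n)%N ->
        (#|[set T : {set binrel n} | `[< maximal_nilpotent_of_class k T >]]|%:Z
         = \sum_(i < k) (-1) ^+ i * 'C(k, i)%:Z * (k - i)%N%:Z ^+ n)%R),
      (* (c) *)
      (forall T1 T2 : {set binrel n},
        maximal_nilpotent T1 -> maximal_nilpotent T2 ->
        (exists s : 'S_n,
           T2 = [set (permrel (s^-1) * t * permrel s)%g | t in T1]) /\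
        subsemigroup_isomorphic T1 T2)
    & (* (d) *)
      (forall T : {set binrel n},
        maximal_nilpotent T -> #|T| = (2 ^ ((n * (n - 1)) %/ 2))%N)].
Proof.
have maxP (T : {set binrel n}) := @maximal_nilpotentP n T hn.
have card_max k : (0 < k <= n)%N ->
    #|[set T : {set binrel n} | `[< maximal_nilpotent_of_class k T >]]|
    = #|surjections n k|.
  move=> kn; rewrite -(card_in_imset (@level_semigroup_inj n k)).
  apply: eq_card => T; rewrite inE.
  apply/asboolP/imsetP => [/(maximal_nilpotent_of_classP _ kn)|fT] //.
  exact/(maximal_nilpotent_of_classP _ kn).
split.
- split; last by move=> T /maxP[f fS ->]; apply: level_semigroup_class.
  rewrite -card_surjections_fact -card_max ?hn ?leqnn //.
  apply: eq_card => T; rewrite !inE; apply: asbool_equiv_eq.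
  by rewrite maxP maximal_nilpotent_of_classP ?hn ?leqnn.
- by move=> k kn; rewrite card_max // card_surjections.
- move=> _ _ /maxP[f fS ->] /maxP[g gS ->].
  have /injectiveP finj : injectiveb f by rewrite -surjections_bij.
  have /injectiveP ginj : injectiveb g by rewrite -surjections_bij.
  (* Permutations multiply from left to right: [s] applies [f], then the inverse of [g]. *)
  pose s : 'S_n := (perm finj * (perm ginj)^-1)%g.
  have gs i : g (s i) = f i by rewrite permM -[g _](permE ginj) permKV permE.
  have fg := conj_level_semigroup gs.
  split; first by exists s; rewrite -fg.
  exists (conjrel s); split=> //.
  + by move=> a b _ _; apply: conjrel_inj.
  + by move=> a b _ _; apply: conjrelM.
- by move=> T /maxP[f fS ->]; apply: card_level_semigroup.
Qed.
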